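(* Let $p$ be a prime and let $r\ge 1$, $\lambda\ge 0$ be integers. The number of isomorphism classes of rings with property (T), of characteristic $p$, having invariants $p,n,r,s,t,\lambda$ with $s=t=1$ (so $n=3+\lambda$ and the order is $p^{nr}$) is $$r\cdot\binom{r+\lambda-1}{\lambda}.$$ Of these isomorphism classes, exactly one consists of commutative rings; the others are non-commutative.
   Context: All rings are finite, associative, with identity. A finite ring $R$ has property (T) if the set $M$ of all its zero-divisors (including $0$) is an ideal (so $R$ is completely primary with Jacobson radical $M$), $M^3=0$ and $M^2\ne 0$. Compatible matrices: for a finite field $F$, matrices $A_k=(a^k_{ij})\in M_s(F)$, $1\le k\le t$, are called compatible if they are linearly independent over $F$ and for each $i\in\{1,\dots,s\}$ there are $j,k$ with $a^k_{ij}\ne0$ or $a^k_{ji}\neq 0$. Construction A: let $F=GF(p^r)$, $s\ge1$, $1\le t\le s^2$, $\lambda\ge0$. Take compatible matrices $A_1,\dots,A_t\in M_s(F)$, $A_k=(a_{ij}^k)$, and automorphisms $\sigma_1,\dots,\sigma_s,\theta_1,\dots,\theta_{t+\lambda}\in \mathrm{Aut}(F)$ (repetitions allowed) such that for $1\le k\le t$, $a^k_{ij}\neq 0$ implies $\theta_k=\sigma_i\sigma_j$. Put $a^k_{ij}=0$ for $k>t$. Let $U$ and $N$ be $F$-vector spaces with bases $u_1,\dots,u_s$ and $w_1,\dots,w_{t+\lambda}$. The ring of Construction A is the additive group $F\oplus U\oplus N$ with multiplication $$\Big(\alpha_0,\sum_i\alpha_iu_i,\sum_k\gamma_kw_k\Big)\Big(\alpha_0',\sum_i\alpha_i'u_i,\sum_k\gamma_k'w_k\Big)=\Big(\alpha_0\alpha_0',\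 \sum_i[\alpha_0\alpha_i'+\alpha_i(\alpha_0')^{\sigma_i}]u_i,\ \sum_k\big[\alpha_0\gamma_k'+\gamma_k(\alpha_0')^{\theta_k}+\sum_{i,j=1}^s a^k_{ij}\alpha_i(\alpha_j')^{\sigma_i}\big]w_k\Big).$$ The rings with property (T) and characteristic $p$ are, up to isomorphism, exactly the rings of Construction A. A ring is said to have invariants $p,n,r,s,t,\lambda$ if it is isomorphic to a ring of Construction A with these parameters, where $n=1+s+t+\lambda$ (so its order is $p^{nr}$). *)

(* Defs.v *)
From HB Require Import structures.
From mathcomp Require Import all_boot all_order all_algebra ring.

Set Implicit Arguments.
Unset Strict Implicit.
Unset Printing Implicit Defensive.

Import GRing.Theory.
Local Open Scope ring_scope.

Definition ring_iso (R S : nzRingType) : Prop :=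
  exists f : {rmorphism R -> S}, bijective f.

Definition is_commutative (R : nzRingType) : Prop :=
  forall x y : R, x * y = y * x.

Section PropertyT.
Variable R : nzRingType.

(* 0 is a zero-divisor because R is not the zero ring. *)
Definition zero_divisor (x : R) : Prop :=
  exists2 y : R, y != 0 & x * y = 0 \/ y * x = 0.

Definition is_ideal (I : R -> Prop) : Prop :=
  [/\ I 0,
      forall x y, I x -> I y -> I (x - y),
      forall a x, I x -> I (a * x)
    & forall a x, I x -> I (x * a)].

Definition ideal_mul (I J : R -> Prop) (z : R) : Prop :=
  exists (n : nat) (x y : 'I_n -> R),
    (forall i, I (x i) /\ J (y i)) /\ z = \sum_(i < n) x i * y i.

Definition property_T : Prop :=
  let M := zero_divisor in
  [/\ is_ideal M,
      forall z, ideal_mul (ideal_mul M M) M z -> z = 0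
    & exists2 z, ideal_mul M M z & z != 0].

End PropertyT.

Record field_aut (F : finFieldType) := FieldAut {
  field_aut_fun :> {rmorphism F -> F};
  field_aut_bij : bijective field_aut_fun }.

Definition compatible (F : finFieldType) (s t : nat)
    (A : 'I_t -> 'M[F]_s) : Prop :=
  free [tuple A k | k < t] /\
  forall i : 'I_s, exists (j : 'I_s) (k : 'I_t), A k i j != 0 \/ A k j i != 0.

(* theta_k = sigma_i sigma_j is read as x |-> sigma_i (sigma_j x); the order is
   immaterial since the automorphism group of a finite field is abelian. *)
Record constrA_data (F : finFieldType) (s t lam : nat) := ConstrAData {
  cA_mx : 'I_t -> 'M[F]_s;
  cA_sigma : 'I_s -> field_aut F;
  cA_theta : 'I_(t + lam) -> field_aut F;
  cA_compatible : compatible cA_mx;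
  cA_theta_eq : forall (k : 'I_t) (i j : 'I_s), cA_mx k i j != 0 ->
    cA_theta (lshift lam k) =1 cA_sigma i \o cA_sigma j }.

(* The coefficients a^k_(i, j), extended by 0 for k > t. *)
Definition cA_coef (F : finFieldType) (s t lam : nat)
    (D : constrA_data F s t lam) (k : 'I_(t + lam)) : 'M[F]_s :=
  match split k with inl k' => cA_mx D k' | inr _ => 0 end.

(* The triple (a, u, w) stands for (alpha_0, (alpha_i)_i, (gamma_k)_k); the
   data D only enters through the multiplication. *)
Definition constrA (F : finFieldType) (s t lam : nat)
    (D : constrA_data F s t lam) : Type :=
  (F * 'rV[F]_s * 'rV[F]_(t + lam))%type.

Section ConstructionA.
Variables (F : finFieldType) (s t lam : nat) (D : constrA_data F s t lam).

Local Notation sigma := (cA_sigma D).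
Local Notation theta := (cA_theta D).

HB.instance Definition _ := Finite.on (constrA D).
HB.instance Definition _ := GRing.Zmodule.on (constrA D).

Definition constrA_one : constrA D := (1, 0, 0).

Definition constrA_mul (x y : constrA D) : constrA D :=
  let: (a, u, w) := x in
  let: (a', u', w') := y in
  (a * a',
   \row_i (a * u' 0 i + u 0 i * sigma i a'),
   \row_k (a * w' 0 k + w 0 k * theta k a' +
           \sum_i \sum_j cA_coef D k i j * u 0 i * sigma i (u' 0 j))).

Lemma cA_coef_theta k i j a :
  cA_coef D k i j * theta k a = cA_coef D k i j * sigma i (sigma j a).
Proof.
rewrite /cA_coef; case: (split_ordP k) => k' ->; last by rewrite mxE !mul0r.
have [->|nz] := eqVneq (cA_mx D k' i j) 0; first by rewrite !mul0r.
by rewrite (cA_theta_eq nz).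
Qed.

Lemma constrA_mulA : associative constrA_mul.
Proof.
move=> [[a u] w] [[a' u'] w'] [[a'' u''] w''] /=.
congr (_, _, _); first by rewrite mulrA.
  by apply/rowP=> i; rewrite !mxE rmorphM mulrDr mulrDl !mulrA addrA.
apply/rowP=> k; rewrite !mxE rmorphM !(mulrDr, mulrDl) !mulrA -!addrA.
congr (_ + (_ + _)).
rewrite addrCA; congr (_ + _); rewrite mulr_sumr mulr_suml -!big_split /=.
apply: eq_bigr => i _.
rewrite mulr_sumr mulr_suml -!big_split /=; apply: eq_bigr => j _.
rewrite !mxE rmorphD !rmorphM !(mulrDr, mulrDl).
have e : cA_coef D k i j * u 0 i * sigma i (u' 0 j) * theta k a'' =
    cA_coef D k i j * u 0 i * (sigma i (u' 0 j) * sigma i (sigma j a'')).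
  transitivity (cA_coef D k i j * theta k a'' * (u 0 i * sigma i (u' 0 j))).
    by ring.
  by rewrite cA_coef_theta; ring.
by rewrite e; ring.
Qed.

Lemma constrA_mul1 : left_id constrA_one constrA_mul.
Proof.
move=> [[a u] w] /=; congr (_, _, _); first by rewrite mul1r.
  by apply/rowP=> i; rewrite !mxE mul1r mul0r addr0.
apply/rowP=> k; rewrite !mxE mul1r mul0r addr0 big1 ?addr0 // => i _.
by apply: big1 => j _; rewrite mxE mulr0 mul0r.
Qed.

Lemma constrA_1mul : right_id constrA_one constrA_mul.
Proof.
move=> [[a u] w] /=; congr (_, _, _); first by rewrite mulr1.
  by apply/rowP=> i; rewrite !mxE rmorph1 mulr0 add0r mulr1.
apply/rowP=> k; rewrite !mxE rmorph1 mulr0 add0r mulr1 big1 ?addr0 // => i _.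
by apply: big1 => j _; rewrite mxE rmorph0 mulr0.
Qed.

Lemma constrA_mulDl : left_distributive constrA_mul +%R.
Proof.
move=> [[a u] w] [[a' u'] w'] [[a'' u''] w''] /=.
congr (_, _, _); first by rewrite /= mulrDl.
  by apply/rowP=> i; rewrite !mxE /=; ring.
apply/rowP=> k; rewrite !mxE /= !mulrDl.
under eq_bigr => i _.
  under eq_bigr => j _ do rewrite mxE mulrDr mulrDl.
  rewrite big_split /=; over.
by rewrite big_split /=; ring.
Qed.

Lemma constrA_mulDr : right_distributive constrA_mul +%R.
Proof.
move=> [[a u] w] [[a' u'] w'] [[a'' u''] w''] /=.
congr (_, _, _); first by rewrite /= mulrDr.
  by apply/rowP=> i; rewrite !mxE /= rmorphD; ring.
apply/rowP=> k; rewrite !mxE /= rmorphD !mulrDr.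
under eq_bigr => i _.
  under eq_bigr => j _ do rewrite mxE rmorphD mulrDr.
  rewrite big_split /=; over.
by rewrite big_split /=; ring.
Qed.

Lemma constrA_one_neq0 : constrA_one != 0.
Proof. by apply/eqP=> -[/eqP]; rewrite oner_eq0. Qed.

HB.instance Definition _ := GRing.Zmodule_isNzRing.Build (constrA D)
  constrA_mulA constrA_mul1 constrA_1mul constrA_mulDl constrA_mulDr
  constrA_one_neq0.

End ConstructionA.

Definition has_invariants (p n r s t lam : nat) (R : finNzRingType) : Prop :=
  [/\ (1 <= s)%N, (1 <= t <= s ^ 2)%N, n = (1 + s + t + lam)%N &
      exists (F : finFieldType) (D : constrA_data F s t lam),
        #|F| = (p ^ r)%N /\ ring_iso R (constrA D)].

(* The E i represent, without repetition, all isomorphism classes of rings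
   satisfying P; thus these classes are N in number. *)
Definition iso_representatives (P : finNzRingType -> Prop) (N : nat)
    (E : 'I_N -> finNzRingType) : Prop :=
  [/\ forall i, P (E i),
      forall i j, ring_iso (E i) (E j) -> i = j
    & forall R, P R -> exists i, ring_iso R (E i)].

(* Main.v *)
Require Import Defs.
From HB Require Import structures.
From mathcomp Require Import all_boot all_order all_algebra ring.
From mathcomp Require Import all_fingroup all_solvable all_field.

(** For s = t = 1 every ring of Construction A is isomorphic to one with
    a_11 = 1 over a fixed field F, and its data are then an automorphism sigma
    (with theta_1 = sigma^2) and the list of theta_2, ..., theta_(1 + lambda) up
    to order. As Aut(F) is cyclic of order r, generated by the Frobenius map,
    this leaves r choices for sigma and C(r + lambda - 1, lambda) multisets of
    exponents. No two of these rings are isomorphic: if J is the radical and N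
    its annihilator, then sigma = Frob^l iff y a - a^(p^l) y lies in N for all
    y in J and all a, while the y in N with y a = a^(p^l) y for all a number
    |F|^m, where m is the multiplicity of Frob^l among all the theta_k. *)

Set Implicit Arguments.
Unset Strict Implicit.
Unset Printing Implicit Defensive.

Import GRing.Theory.
Local Open Scope ring_scope.

(** * Finite fields: powers of Frobenius, automorphisms, uniqueness *)

Section FrobeniusPower.
Variables (F : finFieldType) (p : nat) (chFp : p \in [pchar F]).

(* The proof that F has characteristic p is an argument so that the ring
   morphism instances below can be inferred. *)
Definition frob_pow of p \in [pchar F] := fun (i : nat) (x : F) => x ^+ (p ^ i).

Local Notation frob := (frob_pow chFp).

Lemma frob_powD i j x : frob (i + j) x = frob i (frob j x).
Proof. by rewrite /frob_pow addnC expnD exprM. Qed.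

Fact frob_pow_is_zmod_morphism i : zmod_morphism (frob i).
Proof.
elim: i => [|i IHi] x y; first by rewrite /frob_pow !expr1.
by rewrite -addn1 !frob_powD -IHi -(pFrobenius_autB_comm chFp) ?mulrC //; exact: mulrC.
Qed.

Fact frob_pow_is_monoid_morphism i : monoid_morphism (frob i).
Proof. by split=> [|x y]; rewrite /frob_pow ?expr1n ?exprMn. Qed.

HB.instance Definition _ i :=
  GRing.isZmodMorphism.Build F F (frob i) (frob_pow_is_zmod_morphism i).
HB.instance Definition _ i :=
  GRing.isMonoidMorphism.Build F F (frob i) (frob_pow_is_monoid_morphism i).

Lemma frob_pow_bij i : bijective (frob i).
Proof. exact/injF_bij/fmorph_inj. Qed.

Definition frob_aut i : field_aut F := FieldAut (frob_pow_bij i).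

Variables (r : nat) (cardF : #|F| = (p ^ r)%N).

Lemma frob_pow_mod i : frob (i %% r) =1 frob i.
Proof.
have frob_r k : frob (k * r) =1 id.
  elim: k => [|k IHk] x; first by rewrite /frob_pow mul0n expr1.
  by rewrite mulSn frob_powD IHk /frob_pow -cardF expf_card.
by move=> x; rewrite [in RHS](divn_eq i r) frob_powD frob_r.
Qed.

(** If i < j, agreement makes Frob^(j - i) the identity, so all p^r elements of [F] are roots of
    X^(p^(j - i)) - X, whose degree is below p^r. *)
Lemma frob_pow_inj i j : (i < r)%N -> (j < r)%N -> frob i =1 frob j -> i = j.
Proof.
wlog leij : i j / (i <= j)%N.
  move=> IH lti ltj eqij; case/orP: (leq_total i j) => [le|le]; first exact: IH.
  by apply/esym/IH => // x; rewrite eqij.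
move=> lti ltj eqij; have p_gt1 := prime_gt1 (pcharf_prime chFp).
have fix_d x : frob (j - i) x = x.
  have: frob i (frob (j - i) x) = frob i x by rewrite -frob_powD subnKC // eqij.
  exact: fmorph_inj.
apply/eqP; rewrite eqn_leq leij -subn_eq0; case: (j - i)%N fix_d (leq_subr i j).
  by [].
move=> d fix_d ltd; pose P : {poly F} := 'X^(p ^ d.+1) - 'X.
have d_gt1 : (1 < p ^ d.+1)%N by rewrite -(exp1n d.+1) ltn_exp2r.
have szP : size P = (p ^ d.+1).+1.
  by rewrite size_polyDl size_polyXn // size_polyN size_polyX.
have P0 : P != 0 by rewrite -size_poly_gt0 szP.
have: (size (enum F) < size P)%N.
  apply: max_poly_roots => //; last exact: enum_uniq.
  by apply/allP=> x _; rewrite rootE !hornerE_comm hornerXn subr_eq0; apply/eqP/fix_d.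
by rewrite szP -cardE cardF ltnS leq_exp2l // leqNgt (leq_ltn_trans ltd ltj).
Qed.

(** An endomorphism of [F] is linear over the prime field, hence an element of the Galois group,
    which is cyclic and generated by Frobenius. *)
Lemma rmorphism_frob_pow (r_gt0 : (0 < r)%N) (g : {rmorphism F -> F}) :
  exists i : 'I_r, g =1 frob i.
Proof.
pose L : splittingFieldType 'F_p := pPrimeCharType chFp.
have gZ : scalable (g : L -> L).
  by move=> a x; rewrite -[a *: x]/(a%:R * x) rmorphM rmorph_nat.
pose gl : {lrmorphism L -> L} := HB.pack (g : L -> L)
  (GRing.isZmodMorphism.Build L L g (rmorphB g))
  (GRing.isMonoidMorphism.Build L L g (rmorph1 g, rmorphM g))
  (GRing.isScalable.Build _ L L _ g gZ).
have /kAut_to_gal[b galb Db] : kAut 1 {:L} (linfun gl).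
  rewrite kAutfE; apply/kHomP_tmp; split=> [x /vlineP[c ->] | x y _ _].
    by rewrite lfunE linearZ rmorph1.
  by rewrite !lfunE rmorphM.
have [a /eqP gen_a Da] := finField_galois_generator (sub1v {:L}).
move: galb; rewrite gen_a => /cycleP[i def_b].
have Dai k x : (a ^+ k)%g x = frob k x.
  elim: k => [|k IHk] in x *; first by rewrite gal_id /frob_pow expr1.
  rewrite expgS galM ?memvf // IHk Da ?memvf // dimv1 card_Fp ?(pcharf_prime chFp) //.
  by rewrite -addn1 frob_powD.
exists (Ordinal (ltn_pmod i r_gt0)) => x /=; rewrite frob_pow_mod -Dai -def_b.
by rewrite -Db ?memvf // lfunE.
Qed.

End FrobeniusPower.

(* F is GF(p)[x] for a generator x of its unit group; sending x to a root in F'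
   of the minimal polynomial of x is well defined. *)
Lemma finField_iso (F F' : finFieldType) :
  #|F| = #|F'| -> exists f : {rmorphism F -> F'}, bijective f.
Proof.
move=> eqFF'; have [p p_pr chFp] := finPcharP F.
have cardF := card_pprimeChar chFp.
have chFp' : p \in [pchar F'].
  by apply: card_finPcharP p_pr; rewrite -eqFF'; exact: cardF.
pose L : splittingFieldType 'F_p := pPrimeCharType chFp.
pose L' : splittingFieldType 'F_p := pPrimeCharType chFp'.
have /cyclicP[u gen_u] := field_unit_group_cyclic [set: {unit F}].
pose x : L := val u.
have ev_x (z : L) : exists P : {poly 'F_p}, (map_poly (in_alg L) P).[x] = z.
  have [->|nz_z] := eqVneq z 0; first by exists 0; rewrite rmorph0 horner0.
  have : finField_unit (nz_z : (z : F) != 0) \in <[u]>%g by rewrite -gen_u inE.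
  case/cycleP=> k def_z; exists 'X^k.
  rewrite map_polyXn hornerXn -[RHS]/(val (finField_unit (nz_z : (z : F) != 0))).
  by rewrite def_z FinRing.val_unitX.
have /polyOver1P[m def_m] := minPolyOver 1 x.
have m_dvd P : (map_poly (in_alg L) P).[x] = 0 -> m %| P.
  move/eqP=> rP; rewrite -(dvdp_map (in_alg L)) -def_m minPoly_dvdp ?rootE //.
  by apply/polyOver1P; exists P.
(* [m] divides X^|F| - X because [x] is a root of the latter. As |F| = |F'|, this polynomial splits
   over [L'] into the factors X - z, so [m], not being constant, has a root there. *)
have [y m_y] : exists y : L', root (map_poly (in_alg L') m) y.
  have m_dvd_q : m %| 'X^#|F'| - 'X.
    apply: m_dvd; rewrite rmorphB /= map_polyXn map_polyX.
    by rewrite hornerD hornerN hornerXn hornerX -eqFF' [X in X - _]expf_card subrr.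
  have : map_poly (in_alg L') m %| \prod_(z <- enum F') ('X - (z : L')%:P).
    move: m_dvd_q; rewrite -(dvdp_map (in_alg L')) rmorphB /= map_polyXn map_polyX.
    by rewrite (finField_genPoly F') big_enum.
  case/dvdp_prod_XsubC=> b eqm.
  have: (1 < size (map_poly (in_alg L') m))%N.
    by rewrite size_map_poly -(size_map_poly (in_alg L)) -def_m size_minPoly.
  rewrite (eqp_size eqm) size_prod_XsubC ltnS -has_predT => /hasP[z z_in _].
  by exists z; rewrite (eqp_root eqm) root_prod_XsubC.
have ev_xb (z : L) : exists P : {poly 'F_p}, (map_poly (in_alg L) P).[x] == z.
  by have [P /eqP] := ev_x z; exists P.
pose f (z : L) : L' := (map_poly (in_alg L') (xchoose (ev_xb z))).[y].
(* Polynomials with the same value at [x] differ by a multiple of [m], so they also agree at [y]. *)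
have fE P : f (map_poly (in_alg L) P).[x] = (map_poly (in_alg L') P).[y].
  apply/eqP; rewrite /f -subr_eq0 -hornerN -hornerD -rmorphB /=.
  have /m_dvd/dvdpP[Q ->] :
      (map_poly (in_alg L) (xchoose (ev_xb (map_poly (in_alg L) P).[x]) - P)).[x] = 0.
    by rewrite rmorphB hornerD hornerN (eqP (xchooseP (ev_xb _))) subrr.
  by rewrite rmorphM hornerM (rootP m_y) mulr0.
have fB : zmod_morphism f.
  move=> z1 z2; have [P1 <-] := ev_x z1; have [P2 <-] := ev_x z2.
  by rewrite -hornerN -hornerD -rmorphB !fE rmorphB hornerD hornerN.
have fM : monoid_morphism f.
  split=> [|z1 z2].
    by have := fE 1; rewrite !rmorph1 !hornerC.
  have [P1 <-] := ev_x z1; have [P2 <-] := ev_x z2.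
  by rewrite -hornerM -rmorphM !fE rmorphM hornerM.
pose fR : {rmorphism F -> F'} := HB.pack (f : F -> F')
  (GRing.isZmodMorphism.Build F F' f fB) (GRing.isMonoidMorphism.Build F F' f fM).
by exists fR; apply: inj_card_bij; [exact: fmorph_inj | rewrite eqFF'].
Qed.

(** * Construction A with s = t = 1 in coordinates *)

Section Coordinates.
Variables (F : finFieldType) (lam : nat) (D : constrA_data F 1 1 lam).
Implicit Types x y : constrA D.

Local Notation sigma := (cA_sigma D 0).
Local Notation theta := (cA_theta D).

Definition alpha_of x : F := x.1.1.
Definition beta_of x : F := x.1.2 0 0.
Definition gamma_of x (k : 'I_(1 + lam)) : F := x.2 0 k.
Definition constrA_mk (a b : F) (c : 'I_(1 + lam) -> F) : constrA D :=
  (a, \row__ b, \row_k c k).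

Lemma alpha_mk a b c : alpha_of (constrA_mk a b c) = a. Proof. by []. Qed.
Lemma beta_mk a b c : beta_of (constrA_mk a b c) = b. Proof. exact: mxE. Qed.
Lemma gamma_mk a b c : gamma_of (constrA_mk a b c) =1 c.
Proof. by move=> k; exact: mxE. Qed.

Lemma alphaD x y : alpha_of (x + y) = alpha_of x + alpha_of y. Proof. by []. Qed.
Lemma betaD x y : beta_of (x + y) = beta_of x + beta_of y. Proof. exact: mxE. Qed.
Lemma gammaD x y k : gamma_of (x + y) k = gamma_of x k + gamma_of y k.
Proof. exact: mxE. Qed.

Lemma alphaN x : alpha_of (- x) = - alpha_of x. Proof. by []. Qed.
Lemma betaN x : beta_of (- x) = - beta_of x. Proof. exact: mxE. Qed.
Lemma gammaN x k : gamma_of (- x) k = - gamma_of x k. Proof. exact: mxE. Qed.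

Lemma alpha0 : alpha_of 0 = 0. Proof. by []. Qed.
Lemma beta0 : beta_of 0 = 0. Proof. exact: mxE. Qed.
Lemma gamma0 k : gamma_of 0 k = 0. Proof. exact: mxE. Qed.

Lemma alpha1 : alpha_of 1 = 1. Proof. by []. Qed.
Lemma beta1 : beta_of 1 = 0. Proof. exact: mxE. Qed.
Lemma gamma1 k : gamma_of 1 k = 0. Proof. exact: mxE. Qed.

Lemma alphaM x y : alpha_of (x * y) = alpha_of x * alpha_of y.
Proof. by move: x y => [[a u] w] [[a' u'] w']. Qed.

Lemma betaM x y :
  beta_of (x * y) = alpha_of x * beta_of y + beta_of x * sigma (alpha_of y).
Proof. by move: x y => [[a u] w] [[a' u'] w']; rewrite /beta_of !mxE. Qed.

Lemma gammaM x y k :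
  gamma_of (x * y) k = alpha_of x * gamma_of y k + gamma_of x k * theta k (alpha_of y) +
    cA_coef D k 0 0 * beta_of x * sigma (beta_of y).
Proof.
by move: x y => [[a u] w] [[a' u'] w']; rewrite /gamma_of !mxE !big_ord1.
Qed.

Lemma alphaX x n : alpha_of (x ^+ n) = alpha_of x ^+ n.
Proof. by elim: n => // n IHn; rewrite !exprS alphaM IHn. Qed.

Lemma constrA_eqP x y :
  [/\ alpha_of x = alpha_of y, beta_of x = beta_of y & gamma_of x =1 gamma_of y] ->
  x = y.
Proof.
move: x y => [[a u] w] [[a' u'] w'] [/= eqa eqb eqc]; congr (_, _, _) => //.
  by apply/rowP=> i; rewrite (ord1 i); exact: eqb.
by apply/rowP=> k; exact: eqc.
Qed.

Definition coordE :=
  (alphaM, betaM, gammaM, alphaD, betaD, gammaD, alphaN, betaN, gammaN,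
   alpha0, beta0, gamma0, alpha1, beta1, gamma1, alpha_mk, beta_mk, gamma_mk, alphaX).

Lemma natr_constrA m : m%:R = constrA_mk m%:R 0 (fun=> 0).
Proof.
elim: m => [|m IHm]; first by apply: constrA_eqP; split=> [||k]; rewrite !coordE.
rewrite !mulrS IHm; apply: constrA_eqP.
by split=> [||k]; rewrite !coordE ?addr0.
Qed.

Lemma pchar_constrA p : p \in [pchar F] -> p \in [pchar (constrA D)].
Proof.
move=> chFp; rewrite inE (pcharf_prime chFp) natr_constrA (pcharf0 chFp).
by apply/eqP; apply: constrA_eqP; split=> [||k]; rewrite !coordE.
Qed.

Lemma cA_mx_neq0 : cA_mx D 0 0 0 != 0.
Proof.
have [_ /(_ 0)[j [k]]] := cA_compatible D.
by rewrite (ord1 j) (ord1 k) => -[].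
Qed.

Lemma cA_coef_lshift k : cA_coef D (lshift lam k) = cA_mx D k.
Proof. by rewrite /cA_coef -[lshift lam k]/(unsplit (inl k)) unsplitK. Qed.

Lemma cA_coef_rshift k : cA_coef D (rshift 1 k) = 0.
Proof. by rewrite /cA_coef -[rshift 1 k]/(unsplit (inr k)) unsplitK. Qed.

Lemma cA_coef0_neq0 : cA_coef D (lshift lam 0) 0 0 != 0.
Proof. by rewrite cA_coef_lshift cA_mx_neq0. Qed.

Lemma cA_theta0 (a : F) : theta (lshift lam 0) a = sigma (sigma a).
Proof. exact: cA_theta_eq cA_mx_neq0 _. Qed.

Lemma card_constrA : #|{: constrA D}| = (#|F| ^ (3 + lam))%N.
Proof.
rewrite (_ : #|{: constrA D}| = #|{: F * 'rV[F]_1 * 'rV[F]_(1 + lam)}|) //.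
by rewrite !card_prod !card_mx !mul1n expn1 !expnS -mulnA.
Qed.

(** A nilpotent element has nilpotent, hence zero, image in the field [F]; conversely M^3 = 0.
    Cubing thus detects the radical in terms of the ring alone. *)
Lemma cube_eq0 x : (x ^+ 3 == 0) = (alpha_of x == 0).
Proof.
apply/eqP/eqP => [x0 | ax0].
  by apply/eqP; move/(congr1 alpha_of)/eqP: x0; rewrite alphaX alpha0 expf_eq0.
rewrite !exprS expr0 mulr1; apply: constrA_eqP; rewrite ?coordE ax0.
by split=> [||k]; rewrite ?coordE ?ax0 ?(mul0r, rmorph0, mulr0, addr0).
Qed.

(** If the F-coordinate of [x] is nonzero and x y = 0 or y x = 0, then the coordinates alpha, beta,
    gamma of [y] vanish in turn. *)
Lemma zero_divisor_constrA x : zero_divisor x <-> alpha_of x = 0.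
Proof.
split=> [[y nz_y xy0] | ax0]; last first.
  (* A nonzero element of N, which every element of the radical annihilates. *)
  exists (constrA_mk 0 0 (fun=> 1)); last first.
    left; apply: constrA_eqP.
    by split=> [||k]; rewrite ?coordE ?ax0 ?(mul0r, rmorph0, mulr0, addr0).
  by apply/eqP=> /(congr1 (fun z => gamma_of z 0))/eqP; rewrite ?coordE oner_eq0.
apply/eqP/idPn=> nz_a; case/eqP: nz_y.
case: xy0 => xy0.
  have ay0 : alpha_of y = 0.
    apply/eqP; move/(congr1 alpha_of)/eqP: xy0.
    by rewrite ?coordE mulf_eq0 (negPf nz_a).
  have by0 : beta_of y = 0.
    apply/eqP; move/(congr1 beta_of)/eqP: xy0.
    by rewrite ?coordE ay0 rmorph0 mulr0 addr0 mulf_eq0 (negPf nz_a).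
  apply: constrA_eqP; rewrite ay0 by0 ?coordE; split=> // k; apply/eqP.
  move/(congr1 (gamma_of^~ k))/eqP: xy0.
  by rewrite ?coordE ay0 by0 !rmorph0 !mulr0 !addr0 mulf_eq0 (negPf nz_a).
have ay0 : alpha_of y = 0.
  apply/eqP; move/(congr1 alpha_of)/eqP: xy0.
  by rewrite ?coordE mulf_eq0 (negPf nz_a) orbF.
have by0 : beta_of y = 0.
  apply/eqP; move/(congr1 beta_of)/eqP: xy0.
  by rewrite ?coordE ay0 mul0r add0r mulf_eq0 fmorph_eq0 (negPf nz_a) orbF.
apply: constrA_eqP; rewrite ay0 by0 ?coordE; split=> // k; apply/eqP.
move/(congr1 (gamma_of^~ k))/eqP: xy0.
rewrite ?coordE ay0 by0 mulr0 !mul0r add0r addr0 mulf_eq0 fmorph_eq0.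
by rewrite (negPf nz_a) orbF.
Qed.

Lemma property_T_constrA : property_T (constrA D).
Proof.
split.
- split=> [|x y|a x|a x]; rewrite ?zero_divisor_constrA ?coordE //.
  + by move=> -> ->; rewrite subr0.
  + by move=> ->; rewrite mulr0.
  + by move=> ->; rewrite mul0r.
- move=> _ [n [x [y [xy ->]]]]; apply: big1 => i _.
  have [[m [x' [y' [xy' ->]]]] /zero_divisor_constrA ay0] := xy i.
  rewrite mulr_suml; apply: big1 => j _.
  have [/zero_divisor_constrA ax0 /zero_divisor_constrA ay'0] := xy' j.
  apply: constrA_eqP.
  by split=> [||k]; rewrite ?coordE ?(ay0, ax0, ay'0) ?(mul0r, rmorph0, mulr0, addr0).
(* The coordinate of u_1^2 at w_1 is the matrix entry a_11, nonzero by compatibility. *)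
pose u := constrA_mk 0 1 (fun=> 0); exists (u * u).
  exists 1%N, (fun=> u), (fun=> u); rewrite big_ord1; split=> // _.
  by split; apply/zero_divisor_constrA; rewrite ?coordE.
apply/eqP=> /(congr1 (fun z => gamma_of z (lshift lam 0)))/eqP.
by rewrite ?coordE rmorph1 !(mul0r, add0r, mulr1) (negPf cA_coef0_neq0).
Qed.

End Coordinates.

(** * Isomorphisms induced by a change of data *)

Section TransportIso.
Variables (F F' : finFieldType) (lam : nat).
Variables (D : constrA_data F 1 1 lam) (D' : constrA_data F' 1 1 lam).
Variables (tau : {rmorphism F -> F'}) (rho : {perm 'I_(1 + lam)}).
Variable d : 'I_(1 + lam) -> F.
Hypotheses (tau_bij : bijective tau) (d_neq0 : forall k, d k != 0).
Hypothesis tau_sigma : forall x, cA_sigma D' 0 (tau x) = tau (cA_sigma D 0 x).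
Hypothesis tau_theta :
  forall k x, cA_theta D' k (tau x) = tau (cA_theta D (rho k) x).
Hypothesis tau_coef :
  forall k, cA_coef D' k 0 0 = tau (d k * cA_coef D (rho k) 0 0).

Let f (x : constrA D) : constrA D' :=
  constrA_mk D' (tau (alpha_of x)) (tau (beta_of x))
    (fun k => tau (d k * gamma_of x (rho k))).

(** [tau] moves the coefficients, [rho] permutes the w_k and [d] rescales them. Rescaling leaves
    each theta_k unchanged and multiplies the entry a^k_11 by [d k]. *)
Lemma constrA_transport_iso : ring_iso (constrA D) (constrA D').
Proof.
have fB : zmod_morphism f.
  move=> x y; apply: constrA_eqP.
  by split=> [||k]; rewrite ?coordE ?rmorphB // mulrBr rmorphB.
have fM : monoid_morphism f.
  split=> [|x y]; apply: constrA_eqP.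
    by split=> [||k]; rewrite ?coordE ?mulr0 ?rmorph0 ?rmorph1.
  split=> [||k]; rewrite ?coordE ?tau_sigma ?tau_theta ?tau_coef -?rmorphM -?rmorphD //.
  by congr (tau _); rewrite !mulrDr !mulrA (mulrC (d k)).
pose fR : {rmorphism constrA D -> constrA D'} := HB.pack f
  (GRing.isZmodMorphism.Build _ _ f fB) (GRing.isMonoidMorphism.Build _ _ f fM).
exists fR; apply: inj_card_bij => [x y /= eqf|]; last first.
  by rewrite !card_constrA (bij_eq_card tau_bij).
have inj := fmorph_inj tau; apply: constrA_eqP; split=> [||k].
- by apply: inj; have := congr1 (@alpha_of _ _ _) eqf; rewrite ?coordE.
- by apply: inj; have := congr1 (@beta_of _ _ _) eqf; rewrite ?coordE.
rewrite -(permKV rho k); apply: (mulfI (d_neq0 (rho^-1%g k))); apply: inj.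
by have := congr1 (fun z => gamma_of z (rho^-1%g k)) eqf; rewrite ?coordE.
Qed.

End TransportIso.

(** * Isomorphism invariants of a finite ring *)

Lemma forallb_bij (T T' : finType) (f : T -> T') (P : pred T') :
  bijective f -> [forall x, P x] = [forall x, P (f x)].
Proof.
case=> g _ gK; apply/forallP/forallP => [Pf x | Pf x]; first exact: Pf.
by rewrite -[x]gK; exact: Pf.
Qed.

Section Invariants.
Variable R : finNzRingType.

(* For R = constrA D with s = t = 1, the cube-zero elements form the radical J
   and [rad_ann] is its annihilator N.  Twisting by a^q rather than by an
   automorphism of R / J makes both invariants independent of how R / J is
   identified with F. *)
Definition rad_ann : {set R} :=
  [set y | [forall x : R, (x ^+ 3 == 0) ==> (y * x == 0)]].

Definition twisted_by (q : nat) : bool :=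
  [forall y : R, forall a : R, (y ^+ 3 == 0) ==> (y * a - a ^+ q * y \in rad_ann)].

Definition twist_part (q : nat) : {set R} :=
  [set y in rad_ann | [forall a : R, y * a == a ^+ q * y]].

End Invariants.
Arguments rad_ann : clear implicits.

Section InvariantsIso.
Variables (R S : finNzRingType) (f : {rmorphism R -> S}) (f_bij : bijective f).

Let rmorph_bij_eq0 x : (f x == 0) = (x == 0).
Proof. exact: raddf_eq0 (bij_inj f_bij). Qed.

Lemma mem_rad_ann_iso y : (f y \in rad_ann S) = (y \in rad_ann R).
Proof.
rewrite !inE (forallb_bij _ f_bij); apply: eq_forallb => x.
by rewrite -rmorphXn -rmorphM !rmorph_bij_eq0.
Qed.

Lemma twisted_by_iso q : twisted_by R q = twisted_by S q.
Proof.
rewrite /twisted_by [RHS](forallb_bij _ f_bij); apply: eq_forallb => y.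
rewrite [RHS](forallb_bij _ f_bij); apply: eq_forallb => a.
by rewrite -!rmorphXn -!rmorphM -rmorphB rmorph_bij_eq0 mem_rad_ann_iso.
Qed.

Lemma card_twist_part_iso q : #|twist_part R q| = #|twist_part S q|.
Proof.
rewrite -(card_imset _ (bij_inj f_bij)); apply: eq_card => y.
have [g _ gK] := f_bij; rewrite -[y]gK mem_imset; last exact: bij_inj.
rewrite ![_ \in twist_part _ _]inE mem_rad_ann_iso [in RHS](forallb_bij _ f_bij).
congr (_ && _); apply: eq_forallb => a.
by rewrite -rmorphXn -!rmorphM (inj_eq (bij_inj f_bij)).
Qed.

End InvariantsIso.

(** * Values of the invariants on Construction A *)

Section InvariantsConstrA.
Variables (F : finFieldType) (lam : nat) (D : constrA_data F 1 1 lam).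
Local Notation sigma := (cA_sigma D 0).
Local Notation theta := (cA_theta D).
Implicit Type y : constrA D.

Lemma mem_rad_ann_constrA y :
  (y \in rad_ann (constrA D)) = (alpha_of y == 0) && (beta_of y == 0).
Proof.
rewrite inE; apply/forallP/andP => [y_ann | [/eqP ay0 /eqP by0] x].
  (* Testing against u_1 suffices: y u_1 has beta-coordinate alpha_y and w_1-coordinate a_11
     beta_y. *)
  have u_cube : constrA_mk D 0 1 (fun=> 0) ^+ 3 == 0 by rewrite cube_eq0 ?coordE.
  have /implyP/(_ u_cube)/eqP yu0 := y_ann (constrA_mk D 0 1 (fun=> 0)).
  have := congr1 (@beta_of _ _ _) yu0.
  have := congr1 (fun z => gamma_of z (lshift lam 0)) yu0.
  rewrite !coordE rmorph1 !rmorph0 !mulr0 !mulr1 !addr0 => yg0 ->; rewrite eqxx.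
  by split=> //; move/eqP: yg0; rewrite add0r mulf_eq0 (negPf (cA_coef0_neq0 D)).
rewrite cube_eq0; apply/implyP => /eqP ax0; apply/eqP; apply: constrA_eqP.
by split=> [||k]; rewrite !coordE ay0 ax0 ?by0 ?(mul0r, rmorph0, mulr0, addr0).
Qed.

(** For y in the radical, y a - a^q y has alpha-coordinate 0 and beta-coordinate beta_y
    (sigma(alpha_a) - alpha_a^q); take beta_y = 1. *)
Lemma twisted_by_constrA q :
  twisted_by (constrA D) q <-> forall a, sigma a = a ^+ q.
Proof.
split=> [tw a | sigmaE].
  move/forallP/(_ (constrA_mk D 0 1 (fun=> 0)))/forallP: tw.
  move/(_ (constrA_mk D a 0 (fun=> 0))); rewrite cube_eq0 coordE eqxx.
  rewrite mem_rad_ann_constrA; case/andP=> _; rewrite !coordE mul0r add0r mul1r rmorph0 mulr0 addr0 mulr1.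
  by rewrite subr_eq0 => /eqP.
apply/forallP=> y; apply/forallP=> a; rewrite cube_eq0; apply/implyP=> /eqP ay0.
rewrite mem_rad_ann_constrA !coordE ay0 rmorph0 !mul0r !mulr0 subr0 eqxx /=.
by rewrite add0r addr0 sigmaE mulrC subrr.
Qed.

(** On N the condition y a = a^q y splits by coordinates: gamma_k is arbitrary where theta_k is the
    q-th power map and 0 elsewhere. *)
Lemma card_twist_part_constrA q :
  #|twist_part (constrA D) q| =
    (#|F| ^ #|[pred k | [forall a, theta k a == a ^+ q]]|)%N.
Proof.
set K := [pred k | _]; pose h (g : {ffun 'I_(1 + lam) -> F}) := constrA_mk D 0 0 g.
have h_inj : injective h.
  move=> g g' eqh; apply/ffunP=> k.
  by have := congr1 (fun z => gamma_of z k) eqh; rewrite !coordE.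
(* The count is that of the functions into [F] with support in [K], the default value outside [K]
   being 0. *)
rewrite -[#|F|](@eq_card _ F predT) // -(card_pffun_on 0 K predT) -(card_imset _ h_inj).
apply: eq_card => y; rewrite inE mem_rad_ann_constrA.
apply/andP/imsetP => [[/andP[/eqP ay0 /eqP by0] /forallP y_tw] |
                       [g /pffun_onP[/subsetP gK _] ->]].
  exists [ffun k => gamma_of y k]; last first.
    by apply: constrA_eqP; split=> [||k]; rewrite !coordE ?ffunE.
  apply/pffun_onP; split=> //; apply/subsetP=> k; rewrite !inE ffunE => nz_yk.
  apply/forallP=> a.
  have := congr1 (fun z => gamma_of z k) (eqP (y_tw (constrA_mk D a 0 (fun=> 0)))).
  rewrite !coordE ay0 by0 !(rmorph0, mulr0, mul0r, addr0, add0r) mulrC.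
  by move/(mulIf nz_yk)/eqP.
rewrite !coordE !eqxx; split=> //; apply/forallP=> a; apply/eqP; apply: constrA_eqP.
split=> [||k]; rewrite !coordE ?(mul0r, rmorph0, mulr0, addr0, add0r) //.
have [->|nz_gk] := eqVneq (g k) 0; first by rewrite mul0r mulr0.
by have /gK/forallP/(_ (alpha_of a))/eqP-> : k \in support g; rewrite // mulrC.
Qed.

End InvariantsConstrA.

(** * Standard forms and their invariants *)

Section StandardForm.
Variables (F : finFieldType) (p r lam : nat) (chFp : p \in [pchar F]).
Variables (i : 'I_r) (t : lam.-tuple 'I_r).

Let A (k : 'I_1) : 'M[F]_1 := const_mx 1.

Fact std_compatible : compatible A.
Proof.
have A_neq0 : A 0 0 0 != 0 by rewrite mxE oner_eq0.
split; last by move=> k; exists 0, 0; rewrite (ord1 k); left.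
rewrite (_ : tval _ = [:: A 0]); last by rewrite /= enum_ordSl enum_ord0.
by rewrite seq1_free; apply: contraNneq A_neq0 => ->; rewrite mxE.
Qed.

(** Exponents of Frobenius for the theta_k. The first is forced by theta_1 = sigma^2; it is not
    reduced modulo r, hence the [%% r] in the statements below. *)
Definition std_exponent (k : 'I_(1 + lam)) : nat :=
  match split k with inl _ => i + i | inr k' => tnth t k' end.

Lemma std_exponent_lshift k : std_exponent (lshift lam k) = (i + i)%N.
Proof. by rewrite /std_exponent -[lshift lam k]/(unsplit (inl k)) unsplitK. Qed.

Lemma std_exponent_rshift k : std_exponent (rshift 1 k) = tnth t k.
Proof. by rewrite /std_exponent -[rshift 1 k]/(unsplit (inr k)) unsplitK. Qed.

Fact std_theta_eq (k j1 j2 : 'I_1) : A k j1 j2 != 0 ->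
  frob_aut chFp (std_exponent (lshift lam k)) =1 frob_aut chFp i \o frob_aut chFp i.
Proof. by move=> _ x; rewrite std_exponent_lshift; exact: frob_powD. Qed.

Definition std_data : constrA_data F 1 1 lam :=
  @ConstrAData F 1 1 lam A (fun=> frob_aut chFp i)
    (fun k => frob_aut chFp (std_exponent k)) std_compatible std_theta_eq.

Hypotheses (r_gt0 : (0 < r)%N) (cardF : #|F| = (p ^ r)%N).

Lemma frob_pow_eqP e (l : 'I_r) :
  [forall a, frob_pow chFp e a == a ^+ (p ^ l)] = (e %% r == l)%N.
Proof.
apply/forallP/eqP => [eq_e | <- a]; last exact/eqP/esym/frob_pow_mod.
apply: (@frob_pow_inj _ _ chFp _ cardF); rewrite ?ltn_pmod // => a.
by rewrite frob_pow_mod //; apply/eqP.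
Qed.

Lemma twisted_by_std (l : 'I_r) : twisted_by (constrA std_data) (p ^ l) = (l == i).
Proof.
rewrite -val_eqE eq_sym -[val i](modn_small (ltn_ord i)) -frob_pow_eqP.
apply/idP/forallP => [/twisted_by_constrA tw a | eq_i]; first exact/eqP/tw.
by apply/twisted_by_constrA => a; apply/eqP/eq_i.
Qed.

Lemma card_twist_part_std (l : 'I_r) :
  #|twist_part (constrA std_data) (p ^ l)| =
    (#|F| ^ (((i + i) %% r == l) + count_mem l t))%N.
Proof.
rewrite card_twist_part_constrA; congr (_ ^ _)%N.
rewrite -sum1_card big_mkcond big_split_ord big_ord1 /=; congr (_ + _)%N.
  by rewrite inE [in LHS]frob_pow_eqP std_exponent_lshift; case: eqP.
rewrite -sum1_count big_tuple [RHS]big_mkcond; apply: eq_bigr => k _.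
by rewrite inE [in LHS]frob_pow_eqP std_exponent_rshift modn_small // val_eqE.
Qed.

(** Commuting scalars with u_1 and with the w_k forces sigma and every theta_k with k > 1 to be the
    identity, so their exponents, being below r, are 0. Conversely, with trivial automorphisms the
    product formula is symmetric. *)
Lemma is_commutative_std :
  is_commutative (constrA std_data) <->
    i = 0%N :> nat /\ forall k, tnth t k = 0%N :> nat.
Proof.
have frob0 e (lt_er : (e < r)%N) : (forall a, frob_pow chFp e a = a) -> e = 0%N.
  by move=> fix_e; apply: (@frob_pow_inj _ _ chFp _ cardF).
split=> [comm | [i0 t0] x y].
  have comm_a a y := comm (constrA_mk std_data a 0 (fun=> 0)) y.
  split=> [|k].
    apply: frob0 => // a.
    have := congr1 (@beta_of _ _ _) (comm_a a (constrA_mk std_data 0 1 (fun=> 0))).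
    by rewrite !coordE !(rmorph0, mul0r, mulr0, mulr1, mul1r, add0r, addr0).
  apply: frob0 => // a.
  have := congr1 (fun z => gamma_of z (rshift 1 k))
    (comm_a a (constrA_mk std_data 0 0 (fun=> 1))).
  rewrite !coordE !(rmorph0, mul0r, mulr0, mulr1, mul1r, add0r, addr0) /=.
  by rewrite std_exponent_rshift.
have id_e k a : frob_pow chFp (std_exponent k) a = a.
  case: (split_ordP k) => k' ->;
    rewrite ?std_exponent_lshift ?std_exponent_rshift ?i0 ?t0;
    by rewrite /frob_pow expr1.
have id_i a : frob_pow chFp i a = a by rewrite i0 /frob_pow expr1.
by apply: constrA_eqP; split=> [||k]; rewrite !coordE /= ?id_i ?id_e; ring.
Qed.

End StandardForm.

(** * Classification by standard forms *)

Section StandardFormIso.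
Variables (F : finFieldType) (p r lam : nat) (chFp : p \in [pchar F]).
Hypotheses (r_gt0 : (0 < r)%N) (cardF : #|F| = (p ^ r)%N).

Lemma std_iso_eq (i i' : 'I_r) (t t' : lam.-tuple 'I_r) :
  ring_iso (constrA (std_data chFp i t)) (constrA (std_data chFp i' t')) ->
  i = i' /\ perm_eq t t'.
Proof.
case=> f f_bij.
have eq_i : i = i'.
  apply/eqP; rewrite -(twisted_by_std chFp i' t' r_gt0 cardF).
  by rewrite -(twisted_by_iso f_bij) twisted_by_std.
(* With i = i' known, theta_1 adds the same term to both multiplicities of [l]; cancelling it leaves
   the counts in [t] and [t']. *)
split=> //; apply/allP=> l _; apply/eqP/(@addnI ((i + i) %% r == l)%N).
have q_gt1 : (1 < #|F|)%N := finNzRing_gt1 F.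
apply/eqP; rewrite -(eqn_exp2l _ _ q_gt1) -(card_twist_part_std chFp i t r_gt0 cardF).
by rewrite (card_twist_part_iso f_bij) card_twist_part_std // eq_i.
Qed.

Lemma constrA_std_iso (F' : finFieldType) (D : constrA_data F' 1 1 lam) :
  #|F'| = (p ^ r)%N ->
  exists (i : 'I_r) (t : lam.-tuple 'I_r),
    sorted leq (map val t) /\ ring_iso (constrA D) (constrA (std_data chFp i t)).
Proof.
move=> cardF'; have [tau tau_bij] : exists f : {rmorphism F' -> F}, bijective f.
  by apply: finField_iso; rewrite cardF cardF'.
have chFp' : p \in [pchar F'] by apply: card_finPcharP cardF' (pcharf_prime chFp).
have [i sigmaE] := rmorphism_frob_pow chFp' cardF' r_gt0 (cA_sigma D 0).
have theta_ex k : exists e : 'I_r,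
    [forall a, cA_theta D (rshift 1 k) a == frob_pow chFp' e a].
  have [e eE] := rmorphism_frob_pow chFp' cardF' r_gt0 (cA_theta D (rshift 1 k)).
  by exists e; apply/forallP=> a; apply/eqP/eE.
pose t0 := [tuple xchoose (theta_ex k) | k < lam].
pose leI := relpre (@nat_of_ord r) leq.
(* [s] is the permutation sorting the exponents of theta_2, ..., theta_(1 + lambda);
   [lift_perm ord0 ord0 s] extends it by fixing w_1. *)
have /tuple_permP[s eq_s] : perm_eq (sort leI t0) t0 by rewrite perm_sort.
exists i, [tuple of sort leI t0]; split.
  by rewrite sorted_map; apply: sort_sorted => x y; exact: leq_total.
have thetaE k a : cA_theta D (lift_perm ord0 ord0 s (rshift 1 k)) a =
    a ^+ (p ^ tnth [tuple of sort leI t0] k).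
  have -> : rshift 1 k = lift ord0 k by apply: val_inj.
  rewrite lift_perm_lift; have -> : lift ord0 (s k) = rshift 1 (s k) by apply: val_inj.
  have /forallP/(_ a)/eqP-> := xchooseP (theta_ex (s k)).
  congr (_ ^+ (p ^ nat_of_ord _)).
  by rewrite (tnth_nth i) /= eq_s -(tnth_nth i) !tnth_mktuple.
have lift0E : lift_perm ord0 ord0 s (lshift lam (0 : 'I_1)) = lshift lam (0 : 'I_1).
  have -> : lshift lam (0 : 'I_1) = ord0 by apply: val_inj.
  exact: lift_perm_id.
(* Dividing the first coordinate by a_11 normalizes this entry to 1. *)
pose d (k : 'I_(1 + lam)) : F' := if split k is inl _ then (cA_mx D 0 0 0)^-1 else 1.
apply: (@constrA_transport_iso _ _ _ D _ tau (lift_perm ord0 ord0 s) d) => //.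
- by move=> k; rewrite /d; case: split => _; rewrite ?invr_eq0 ?cA_mx_neq0 ?oner_eq0.
(* Any isomorphism [tau] will do, since p-power maps commute with every ring morphism; the exponents
   are the same over both fields. *)
- by move=> x; rewrite /= sigmaE /frob_pow rmorphXn.
- move=> k x /=; case: (split_ordP k) => k' ->.
    rewrite (ord1 k') lift0E std_exponent_lshift cA_theta0 !sigmaE frob_powD.
    by rewrite /frob_pow !rmorphXn.
  by rewrite std_exponent_rshift thetaE /frob_pow rmorphXn.
move=> k; case: (split_ordP k) => k' ->.
  rewrite (ord1 k') lift0E !cA_coef_lshift mxE.
  rewrite /d -[lshift _ _]/(unsplit (inl 0)) unsplitK.
  by rewrite mulVf ?cA_mx_neq0 // rmorph1.
have -> : rshift 1 k' = lift ord0 k' by apply: val_inj.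
rewrite lift_perm_lift.
have lift_rshift j : lift ord0 j = rshift 1 j :> 'I_(1 + lam) by apply: val_inj.
by rewrite !lift_rshift !cA_coef_rshift !mxE mulr0 rmorph0.
Qed.

End StandardFormIso.

(** * Ring isomorphism as an equivalence, and the count *)

Lemma ring_iso_sym (R S : nzRingType) : ring_iso R S -> ring_iso S R.
Proof.
case=> f [g fK gK].
have gB : zmod_morphism g by move=> x y; rewrite -[x]gK -[y]gK -rmorphB !fK.
have gM : monoid_morphism g.
  by split=> [|x y]; [rewrite -(rmorph1 f) fK | rewrite -[x]gK -[y]gK -rmorphM !fK].
pose gR : {rmorphism S -> R} := HB.pack g
  (GRing.isZmodMorphism.Build S R g gB) (GRing.isMonoidMorphism.Build S R g gM).
by exists gR; exists f.
Qed.

Lemma ring_iso_trans (R S T : nzRingType) :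
  ring_iso R S -> ring_iso S T -> ring_iso R T.
Proof. by case=> f bf [g bg]; exists (g \o f); exact: bij_comp. Qed.

Lemma is_commutative_iso (R S : nzRingType) :
  ring_iso R S -> is_commutative R <-> is_commutative S.
Proof.
suff comm_iso (R' S' : nzRingType) :
    ring_iso R' S' -> is_commutative R' -> is_commutative S'.
  by move=> RS; split; apply: comm_iso => //; exact: ring_iso_sym.
case=> f [g _ gK] comm x y.
by rewrite -[x]gK -[y]gK -!rmorphM comm.
Qed.

Theorem lemma5p1 (p r lam n : nat) (p_prime : prime p) (r_ge1 : (1 <= r)%N)
    (n_eq : n = (3 + lam)%N) :
  let P (R : finNzRingType) :=
    [/\ property_T R, p \in [pchar R] & has_invariants p n r 1 1 lam R] in
  exists E : 'I_(r * 'C(r + lam - 1, lam)) -> finNzRingType,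
    [/\ iso_representatives P E,
        forall i, #|E i| = (p ^ (n * r))%N
      & exists i0, forall i (R : finNzRingType), P R -> ring_iso R (E i) ->
          (is_commutative R <-> i = i0)].
Proof.
case: r r_ge1 => // r' _ P; set r := r'.+1.
have [F chFp cardF] := pPrimePowerField p_prime (ltn0Sn r').
(* Sorted tuples represent multisets of exponents, and there are C(r' + lambda, lambda) of them over
   ['I_r], where r = r' + 1. *)
pose T := setX [set: 'I_r] [set t : lam.-tuple 'I_r | sorted leq (map val t)].
have cardT : (r * 'C(r + lam - 1, lam))%N = #|T|.
  by rewrite cardsX cardsT card_ord card_sorted_tuples addSn subn1 addnC.
pose idx (j : 'I_(r * 'C(r + lam - 1, lam))) := enum_val (cast_ord cardT j).
have idx_inj : injective idx by move=> j k /enum_val_inj/cast_ord_inj.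
have idx_sorted j : sorted leq (map val (idx j).2).
  by have := enum_valP (cast_ord cardT j); rewrite !inE.
have idx_surj i (t : lam.-tuple 'I_r) : sorted leq (map val t) ->
    exists j, idx j = (i, t).
  move=> t_sorted; have itT : (i, t) \in T by rewrite !inE.
  exists (cast_ord (esym cardT) (enum_rank_in itT (i, t))).
  by rewrite /idx cast_ordKV enum_rankK_in.
pose E j : finNzRingType := constrA (std_data chFp (idx j).1 (idx j).2).
have E_spec j : P (E j).
  split; [exact: property_T_constrA | exact: pchar_constrA | ].
  split=> //; exists F, (std_data chFp (idx j).1 (idx j).2); split=> //.
  by exists idfun; exists idfun.
exists E; split.
- split=> // [j k | R [_ _ [_ _ _ [F' [D [cardF' RD]]]]]].
    case/(std_iso_eq (ltn0Sn r') cardF) => eq_i eq_t; apply: idx_inj.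
    rewrite [idx j]surjective_pairing [idx k]surjective_pairing eq_i; congr (_, _).
    (* Sorted lists that are permutations of each other are equal, so isomorphic representatives
       have the same index. *)
    apply/val_inj/(inj_map val_inj)/(sorted_eq leq_trans anti_leq);
      [exact: idx_sorted | exact: idx_sorted | exact: perm_map].
  have [i [t [t_sorted Dt]]] := constrA_std_iso chFp (ltn0Sn r') cardF D cardF'.
  have [j idx_j] := idx_surj i t t_sorted; exists j; apply: ring_iso_trans RD _.
  by rewrite /E idx_j.
- by move=> j; rewrite card_constrA cardF -expnM n_eq mulnC.
(* The commutative class has all exponents 0, that is, sigma and all theta_k are the identity. *)
have zero_sorted : sorted leq (map val [tuple of nseq lam (ord0 : 'I_r)]).
  by rewrite map_nseq; case: (lam) => //=; elim.
have [j0 idx_j0] := idx_surj ord0 _ zero_sorted.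
exists j0 => j R _ /is_commutative_iso->.
rewrite /E is_commutative_std //.
split=> [[i0 t0] | ->].
  apply: idx_inj; rewrite idx_j0 [idx j]surjective_pairing.
  congr (_, _); first exact: val_inj.
  by apply: eq_from_tnth => k; apply: val_inj; rewrite tnth_nseq; exact: t0.
by rewrite idx_j0; split=> // k; rewrite tnth_nseq.
Qed.
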